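(* Let $\mathcal{P}$ be a non-trivial hereditary graph property and let $A_{\mathcal{P}}=\{n\in\mathbb{N}^+ : |\mathcal{P}(n)|\geq 2\}$. (i) If $A_{\mathcal{P}}\neq\emptyset$ is finite with $n$ elements, then there are at least $n$ pairs of graphs $G,H$ which are $F_{\mathcal{P}}$-mates. (ii) If $A_{\mathcal{P}}$ is infinite, then there are infinitely many pairs of graphs $G,H$ which are $F_{\mathcal{P}}$-mates. (iii) If $A_{\mathcal{P}}=\emptyset$, then there are infinitely many pairs of graphs $G,H$ which are $F_{\mathcal{P}}$-mates.
   Context: All graphs are finite, simple, loop-free and have at least one vertex. A graph property $\mathcal{P}$ is a class of graphs closed under isomorphism. It is trivial if it is empty, contains only finitely many graphs up to isomorphism, or contains all graphs; otherwise it is non-trivial. It is hereditary if it is closed under induced subgraphs. $|\mathcal{P}(n)|$ denotes the number of isomorphism classes of graphs of order $n$ in $\mathcal{P}$. For a graph $G$, $c_{\mathcal{P}}(G;i)$ is the number of subsets $A\subseteq V(G)$ with $|A|=i$ such that the induced subgraph $G[A]$ is in $\mathcal{P}$ (with the convention $c_{\mathcal{P}}(G;0)=1$), and $F_{\mathcal{P}}(G;x)=\sum_{i\ge 0} c_{\mathcal{P}}(G;i)x^i$. Two non-isomorphic graphs $G,H$ are $F_{\mathcal{P}}$-mates if $F_{\mathcal{P}}(G;x)=F_{\mathcal{P}}(H;x)$. *)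

(* Defs.v *)
From HB Require Import structures.
From mathcomp Require Import all_boot all_order all_algebra.
From mathcomp Require Import boolp classical_sets functions cardinality.

Set Implicit Arguments.
Unset Strict Implicit.
Unset Printing Implicit Defensive.

Local Open Scope classical_set_scope.

Record sgraph := SGraph {
  vertex :> finType;
  adj : rel vertex;
  adj_sym : symmetric adj;
  adj_irrefl : irreflexive adj;
  vertex_gt0 : (0 < #|vertex|)%N
}.

Definition graph_order (G : sgraph) : nat := #|G|.

Definition isomorphic (G H : sgraph) : Prop :=
  exists f : G -> H,
    bijective f /\ forall x y : G, adj (f x) (f y) = adj x y.

Section Induced.
Variables (G : sgraph) (A : {set G}).
Hypothesis A_gt0 : (0 < #|A|)%N.

Definition induced_adj : rel {x : G | x \in A} :=
  fun x y => adj (val x) (val y).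

Lemma induced_sym : symmetric induced_adj.
Proof. by move=> x y; apply: adj_sym. Qed.

Lemma induced_irrefl : irreflexive induced_adj.
Proof. by move=> x; apply: adj_irrefl. Qed.

Lemma induced_gt0 : (0 < #|{: {x : G | x \in A}}|)%N.
Proof. by rewrite card_sig. Qed.

Definition induced : sgraph :=
  SGraph induced_sym induced_irrefl induced_gt0.
End Induced.

(* [set sgraph] is ill-typed (the universe of [set] lies strictly below that of
   [finType]), so classes of graphs are plain predicates and their numbers of
   isomorphism classes are expressed by families of representatives. *)
Section CountingUpTo.
Variables (T : Type) (E : T -> T -> Prop) (Q : T -> Prop).

Definition at_least_upto (k : nat) : Prop :=
  exists f : 'I_k -> T,
    (forall i, Q (f i)) /\ (forall i j, E (f i) (f j) -> i = j).

Definition finitely_many_upto : Prop :=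
  exists (k : nat) (f : 'I_k -> T), forall x, Q x -> exists i, E x (f i).

Definition infinitely_many_upto : Prop := ~ finitely_many_upto.
End CountingUpTo.

Definition graph_property (P : sgraph -> Prop) : Prop :=
  forall G H : sgraph, isomorphic G H -> P G -> P H.

Definition hereditary (P : sgraph -> Prop) : Prop :=
  forall (G : sgraph) (A : {set G}) (A_gt0 : (0 < #|A|)%N),
    P G -> P (induced A_gt0).

Definition trivial_property (P : sgraph -> Prop) : Prop :=
  [\/ forall G, ~ P G, finitely_many_upto isomorphic P | forall G, P G].

(* n \in A_ P iff |P(n)| >= 2. *)
Definition A_ (P : sgraph -> Prop) : set nat :=
  [set n | (0 < n)%N /\
           at_least_upto isomorphic (fun G => P G /\ graph_order G = n) 2].

(* Graphs are nonempty, so the empty vertex set induces no graph and the value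
   at i = 0 is a convention. *)
Definition c_ (P : sgraph -> Prop) (G : sgraph) (i : nat) : nat :=
  if i == 0%N then 1%N
  else #|[set A : {set G} |
           (#|A| == i) && `[< exists A_gt0 : (0 < #|A|)%N,
                                P (induced A_gt0) >]]%SET|.

Definition F_ (P : sgraph -> Prop) (G : sgraph) : {poly int} :=
  (\poly_(i < (graph_order G).+1) (c_ P G i)%:Z)%R.

Definition mates (P : sgraph -> Prop) (G H : sgraph) : Prop :=
  ~ isomorphic G H /\ F_ P G = F_ P H.

Definition mate_pair (P : sgraph -> Prop) (p : sgraph * sgraph) : Prop :=
  mates P p.1 p.2.

(* Pairs are counted as unordered pairs of isomorphism classes: relabelling or
   swapping G and H does not give a new pair. *)
Definition same_pair (p q : sgraph * sgraph) : Prop :=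
  (isomorphic p.1 q.1 /\ isomorphic p.2 q.2) \/
  (isomorphic p.1 q.2 /\ isomorphic p.2 q.1).

(* Main.v *)
Require Import Defs.
From HB Require Import structures.
From mathcomp Require Import all_boot all_order all_algebra.
From mathcomp Require Import boolp classical_sets functions cardinality.

Local Open Scope classical_set_scope.
Local Open Scope card_scope.

(** If [P G] then every nonempty vertex set of [G] induces a member of [P], so
    [F_ P G] is [(1 + x) ^ n] with [n] the order of [G]; two non-isomorphic
    members of [P] of the same order are therefore mates. This settles the cases
    where [A_ P] is nonempty. If [A_ P] is empty, [P] has exactly one graph of
    each order, and by heredity the one of order 2 decides all the others: [P]
    is the class of all complete graphs or that of all edgeless graphs. Up to
    complementation [F_ P] is then the clique polynomial, which on graphs with
    exactly two edges depends only on the order, and the two edges may either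
    share a vertex or be disjoint. *)

(** * Isomorphism, order and the counting of pairs *)

Lemma isomorphic_sym (G H : sgraph) : isomorphic G H -> isomorphic H G.
Proof.
move=> [f [[g fK gK] f_adj]]; exists g; split; first by exists f.
by move=> x y; rewrite -f_adj !gK.
Qed.

Lemma isomorphic_order (G H : sgraph) :
  isomorphic G H -> graph_order G = graph_order H.
Proof. by move=> [f [f_bij _]]; apply: bij_eq_card f_bij. Qed.

Lemma induced_order (G : sgraph) (A : {set G}) (A_gt0 : (0 < #|A|)%N) :
  graph_order (induced A_gt0) = #|A|.
Proof. exact: card_sig. Qed.

Lemma F_eq (P : sgraph -> Prop) (G H : sgraph) :
  graph_order G = graph_order H -> (forall i, c_ P G i = c_ P H i) ->
  F_ P G = F_ P H.
Proof.
by move=> eqGH eqc; rewrite /F_ eqGH; apply/polyP => i; rewrite !coef_poly eqc.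
Qed.

Lemma same_pair_order (p q : sgraph * sgraph) :
  same_pair p q ->
  graph_order p.1 = graph_order q.1 \/ graph_order p.1 = graph_order q.2.
Proof. by case=> -[/isomorphic_order-> _]; [left | right]. Qed.

(** Finitely many representatives have bounded orders. The bound takes both components of each
    representative, since [same_pair] allows a swap. *)
Lemma infinitely_many_pairs (Q : sgraph * sgraph -> Prop) :
  (forall N, exists2 p, Q p & (N < graph_order p.1)%N) ->
  infinitely_many_upto same_pair Q.
Proof.
move=> Q_unbounded [k [f f_repr]].
pose ord2 i := maxn (graph_order (f i).1) (graph_order (f i).2).
have [p /f_repr[i /same_pair_order eq_pi]] := Q_unbounded (\max_i ord2 i).
have := leq_bigmax (F := ord2) i; rewrite {1}/ord2 geq_max => /andP[le1 le2].
by case: eq_pi => ->; rewrite ltnNge ?le1 ?le2.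
Qed.

(** * Mates among the members of a hereditary property *)

Section HereditaryProperty.
Variable P : sgraph -> Prop.
Hypothesis P_hered : hereditary P.

Lemma c_member (G : sgraph) (i : nat) : P G -> c_ P G i = 'C(graph_order G, i).
Proof.
move=> PG; rewrite /c_; case: eqP => [->|/eqP i_neq0]; first by rewrite bin0.
rewrite -card_draws; apply: eq_card => A; rewrite !inE.
case: eqP => //= card_A; apply/asboolP.
have A_gt0 : (0 < #|A|)%N by rewrite card_A lt0n.
by exists A_gt0; apply: P_hered.
Qed.

Lemma mates_of_A (n : nat) :
  A_ P n -> exists2 p, mate_pair P p & graph_order p.1 = n /\ graph_order p.2 = n.
Proof.
move=> [_ [f [f_P f_inj]]]; exists (f ord0, f ord_max).
  have [[P0 ord_0] [P1 ord_1]] := (f_P ord0, f_P ord_max).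
  split=> [/f_inj//|]; apply: F_eq => /= [|i]; first by rewrite ord_0.
  by rewrite !c_member// ord_0 ord_1.
by case: (f_P ord0) (f_P ord_max) => _ ? [_ ?].
Qed.

Lemma A_of_not_isomorphic (G H : sgraph) :
  P G -> P H -> graph_order G = graph_order H -> ~ isomorphic G H ->
  A_ P (graph_order G).
Proof.
move=> PG PH eqGH niso; split; first exact: vertex_gt0.
exists (fun i : 'I_2 => if i == ord0 then G else H); split.
  by move=> i; case: ifP.
move=> i j; case: ifP => i0; case: ifP => j0.
- by rewrite (eqP i0) (eqP j0).
- by move/niso.
- by move/isomorphic_sym/niso.
(* Both indices differ from [ord0], and ['I_2] has only one other element. *)
- by move=> _; apply/val_inj; case: i i0 => [[|[|i]] i_lt2] //;
    case: j j0 => [[|[|j]] j_lt2].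
Qed.

End HereditaryProperty.

(** * Complete graphs ([b = true]) and edgeless graphs ([b = false]) *)

Definition homogeneous (b : bool) (G : sgraph) : Prop :=
  forall x y : G, x != y -> adj x y = b.

Lemma homogeneous_isomorphic (b : bool) (G H : sgraph) :
  homogeneous b G -> homogeneous b H -> graph_order G = graph_order H ->
  isomorphic G H.
Proof.
move=> homG homH eqGH.
have [f f_bij] : exists f : G -> H, bijective f.
  exists (fun x => enum_val (cast_ord eqGH (enum_rank x))).
  exists (fun y => enum_val (cast_ord (esym eqGH) (enum_rank y))) => x.
    by rewrite enum_valK cast_ordK enum_rankK.
  by rewrite enum_valK cast_ordKV enum_rankK.
exists f; split=> // x y; have [->|neq_xy] := eqVneq x y.
  by rewrite !adj_irrefl.
by rewrite homG// homH// (inj_eq (bij_inj f_bij)).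
Qed.

(** * Properties with at most one member of each order *)

Section UniqueMembers.
Variable P : sgraph -> Prop.
Hypotheses (P_prop : graph_property P) (P_hered : hereditary P).
Hypotheses (P_nontrivial : ~ trivial_property P) (A0 : A_ P = set0).

Lemma member_unique (G H : sgraph) :
  P G -> P H -> graph_order G = graph_order H -> isomorphic G H.
Proof.
move=> PG PH eqGH; apply: contrapT => niso.
by have := @A_of_not_isomorphic P G H PG PH eqGH niso; rewrite A0.
Qed.

(** If all members had order below [n], one representative per order would make [P] finite up to
    isomorphism. So some member has at least [n] vertices, and any [n] of them induce the required
    graph. *)
Lemma member_of_order (n : nat) :
  (0 < n)%N -> exists2 G, P G & graph_order G = n.
Proof.
move=> n_gt0; have [G PG le_nG] : exists2 G, P G & (n <= graph_order G)%N.
  apply: contrapT => P_small; apply: P_nontrivial; apply: Or32.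
  (* [G0] is a placeholder representative for the orders without a member. *)
  have [G0 PG0] : exists G, P G.
    apply: contrapT => P_empty; apply: P_nontrivial; apply: Or31 => G PG.
    by apply: P_empty; exists G.
  have /choice[f f_repr] : forall i : 'I_n, exists H,
      forall G, P G -> graph_order G = i -> isomorphic G H.
    move=> i; have [[H [PH ord_H]]|noH] := pselect (exists H, P H /\ graph_order H = i).
      by exists H => G PG ord_G; apply: member_unique => //; rewrite ord_G.
    by exists G0 => G PG ord_G; case: noH; exists G.
  exists n, f => G PG; have lt_Gn : (graph_order G < n)%N.
    by rewrite ltnNge; apply/negP => le_nG; apply: P_small; exists G.
  by exists (Ordinal lt_Gn); apply: f_repr.
have /card_geqP[s [s_uniq s_size _]] := le_nG.
have card_A : #|[set x in s]%SET| = n by rewrite cardsE (card_uniqP s_uniq).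
have A_gt0 : (0 < #|[set x in s]%SET|)%N by rewrite card_A.
by exists (induced A_gt0); [apply: P_hered | rewrite induced_order].
Qed.

(** Any two vertices of a member induce a copy of the unique member [K] of order 2, so adjacency is
    constant, equal to that in [K]. Conversely, a homogeneous graph is isomorphic to the member of
    its order. *)
Lemma homogeneous_property : exists b, forall G, P G <-> homogeneous b G.
Proof.
have [K PK ord_K] := @member_of_order 2 isT.
have /card_gt1P[u [v [_ _ neq_uv]]] : (1 < graph_order K)%N by rewrite ord_K.
have eq_uv (z : K) : (z == u) || (z == v).
  have : [set u; v]%SET == [set: K]%SET.
    by rewrite eqEcard finset.subsetT cardsT cards2 neq_uv -/(graph_order K) ord_K.
  by move=> /eqP/setP/(_ z); rewrite !inE.
have homP G : P G -> homogeneous (adj u v) G.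
  move=> PG x y neq_xy; have card_xy : #|[set x; y]%SET| = 2 by rewrite cards2 neq_xy.
  have xy_gt0 : (0 < #|[set x; y]%SET|)%N by rewrite card_xy.
  have [f [f_bij f_adj]] : isomorphic (induced xy_gt0) K.
    by apply: member_unique; [exact: P_hered| |rewrite induced_order card_xy].
  pose x' : induced xy_gt0 := exist _ x (set21 x y).
  pose y' : induced xy_gt0 := exist _ y (set22 x y).
  have : f x' != f y' by rewrite (inj_eq (bij_inj f_bij)).
  have <- : adj (f x') (f y') = adj x y by rewrite f_adj.
  (* The distinct images are [u] and [v] in some order; symmetry of [adj] covers the swap. *)
  by case/orP: (eq_uv (f x')) => /eqP->; case/orP: (eq_uv (f y')) => /eqP->;
    rewrite ?eqxx // adj_sym.
exists (adj u v) => G; split=> [/homP//|homG].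
have [H PH ord_H] := @member_of_order (graph_order G) (vertex_gt0 G).
by apply: (P_prop H) => //; apply: (homogeneous_isomorphic (adj u v)) => //; apply: homP.
Qed.

End UniqueMembers.

(** * Graphs with exactly two edges, and their complements *)

(** With [b = false] this is the complement of the graph with edge set [E]. *)
Section EdgeGraph.
Variables (T : finType) (T_gt0 : (0 < #|T|)%N) (E : {set {set T}}) (b : bool).

Definition edge_adj : rel T := fun x y => (x != y) && (([set x; y]%SET \in E) == b).

Lemma edge_adj_sym : symmetric edge_adj.
Proof. by move=> x y; rewrite /edge_adj eq_sym finset.setUC. Qed.

Lemma edge_adj_irrefl : irreflexive edge_adj.
Proof. by move=> x; rewrite /edge_adj eqxx. Qed.

Definition edge_graph : sgraph := SGraph edge_adj_sym edge_adj_irrefl T_gt0.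

Hypotheses (card_E : #|E| = 2) (E_pairs : forall e, e \in E -> #|e| = 2).

(** Phrased through [E] instead of adjacency, so that one notion serves both values of [b]. *)
Definition clique (A : {set T}) : Prop :=
  {in A &, forall x y, x != y -> [set x; y]%SET \in E}.

Lemma homogeneous_induced (A : {set edge_graph}) (A_gt0 : (0 < #|A|)%N) :
  homogeneous b (induced A_gt0) <-> clique A.
Proof.
have adjE (x y : T) : x != y -> (edge_adj x y = b) <-> [set x; y]%SET \in E.
  by rewrite /edge_adj => ->; case: (_ \in _); case: b.
split=> [homA x y xA yA neq_xy|clA [x xA] [y yA]].
  by apply/adjE => //; apply: (homA (exist _ x xA) (exist _ y yA)).
by rewrite -val_eqE => neq_xy; apply/adjE => //; apply: clA.
Qed.

Lemma clique1 (A : {set T}) : #|A| = 1 -> clique A.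
Proof.
by move=> /eqP/cards1P[a ->] x y /set1P-> /set1P->; rewrite eqxx.
Qed.

Lemma clique2 (A : {set T}) : #|A| = 2 -> clique A <-> A \in E.
Proof.
move=> /eqP/cards2P[a [c [neq_ac ->]]]; split=> [|acE x y].
  by apply; rewrite ?set21 ?set22.
by move=> /set2P[]-> /set2P[]->; rewrite ?eqxx // finset.setUC.
Qed.

(* A clique on three vertices would contribute three elements to [E]. *)
Lemma clique_le2 (A : {set T}) : clique A -> (#|A| <= 2)%N.
Proof.
move=> clA; rewrite leqNgt; apply/negP.
move=> /card_gt2P[x [y [z [[xA yA zA] [neq_xy neq_yz neq_zx]]]]].
have : (2 < #|E|)%N.
  apply/card_gt2P; exists [set x; y]%SET, [set y; z]%SET, [set z; x]%SET; split.
    by split; apply: clA.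
  split; apply/eqP.
  - by move/setP/(_ x); rewrite !inE eqxx (negbTE neq_xy) eq_sym (negbTE neq_zx).
  - by move/setP/(_ y); rewrite !inE eqxx (negbTE neq_yz) eq_sym (negbTE neq_xy).
  - by move/setP/(_ z); rewrite !inE eqxx (negbTE neq_zx) eq_sym (negbTE neq_yz).
by rewrite card_E.
Qed.

(** The cliques are the singletons, the two elements of [E], and nothing larger, hence the default
    value 0 of [nth]. The shape of [E] does not enter. *)
Lemma c_edge_graph (P : sgraph -> Prop) (i : nat) :
  (forall G, P G <-> homogeneous b G) ->
  c_ P edge_graph i = nth 0 [:: 1; #|T|; 2] i.
Proof.
move=> P_hom; rewrite /c_; case: i => [//|i] /=.
have P_clique (A : {set edge_graph}) : #|A| = i.+1 ->
    `[< exists A_gt0 : (0 < #|A|)%N, P (induced A_gt0) >] = `[< clique A >].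
  move=> card_A; apply: asbool_equiv_eq; split.
    by move=> [A_gt0 /P_hom/homogeneous_induced].
  move=> clA; have A_gt0 : (0 < #|A|)%N by rewrite card_A.
  by exists A_gt0; apply/P_hom/homogeneous_induced.
case: i P_clique => [|[|i]] P_clique /=.
- rewrite -[RHS]bin1 -card_draws; apply: eq_card => A; rewrite !inE.
  by case: eqP => //= card_A; rewrite P_clique//; apply/asboolP/clique1.
- rewrite -[RHS]card_E; apply: eq_card => A; rewrite !inE.
  case: eqP => /= [card_A|ncard_A].
    by rewrite P_clique//; apply/asboolP/idP => /clique2; apply.
  by apply/esym/negbTE/negP => /E_pairs.
- rewrite nth_nil; apply: eq_card0 => A; rewrite !inE.
  apply/negbTE/negP => /andP[/eqP card_A].
  by rewrite P_clique// => /asboolP/clique_le2; rewrite card_A.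
Qed.

End EdgeGraph.

Arguments edge_graph {T}.

(** Off the diagonal, adjacency compares membership in the edge set with the same [b] on both sides,
    so [b] cancels. *)
Lemma edge_graph_isomorphic (T : finType) (T_gt0 : (0 < #|T|)%N)
    (E E' : {set {set T}}) (b : bool) :
  isomorphic (edge_graph T_gt0 E b) (edge_graph T_gt0 E' b) ->
  exists2 f : T -> T, injective f &
    forall x y, x != y -> ([set f x; f y]%SET \in E') = ([set x; y]%SET \in E).
Proof.
move=> [f [/bij_inj f_inj f_adj]]; exists f => // x y neq_xy.
have := f_adj x y; rewrite /= /edge_adj (inj_eq f_inj) neq_xy /=.
by case: (_ \in E'); case: (_ \in E); case: {f f_inj f_adj} b.
Qed.

Lemma homogeneous_mates (P : sgraph -> Prop) (b : bool) (m : nat) :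
  (forall G, P G <-> homogeneous b G) ->
  exists2 p, mate_pair P p & graph_order p.1 = m.+4.
Proof.
move=> P_hom; pose T : finType := 'I_m.+4.
have T_gt0 : (0 < #|T|)%N by rewrite card_ord.
pose v0 : T := @Ordinal m.+4 0 isT; pose v1 : T := @Ordinal m.+4 1 isT.
pose v2 : T := @Ordinal m.+4 2 isT; pose v3 : T := @Ordinal m.+4 3 isT.
(* A path on three vertices against two disjoint edges; the latter need four vertices, hence
   [m.+4]. *)
pose E := [set [set v0; v1]; [set v1; v2]]%SET.
pose E' := [set [set v0; v1]; [set v2; v3]]%SET.
have card_E : #|E| = 2.
  by rewrite cards2; case: eqP => // /setP/(_ v0); rewrite !inE.
have card_E' : #|E'| = 2.
  by rewrite cards2; case: eqP => // /setP/(_ v0); rewrite !inE.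
have E_pairs e : e \in E -> #|e| = 2 by move=> /set2P[]->; rewrite cards2.
have E'_pairs e : e \in E' -> #|e| = 2 by move=> /set2P[]->; rewrite cards2.
exists (edge_graph T_gt0 E b, edge_graph T_gt0 E' b); last by rewrite /graph_order card_ord.
split=> /=; last by apply: F_eq => // i; rewrite !c_edge_graph.
move=> /edge_graph_isomorphic[f f_inj f_E].
(* The images of the two edges of [E] are distinct elements of [E'] sharing [f v1], whereas the two
   elements of [E'] are disjoint. *)
have e01 : [set f v0; f v1]%SET \in E' by rewrite f_E// set21.
have e12 : [set f v1; f v2]%SET \in E' by rewrite f_E// set22.
have neq : [set f v0; f v1]%SET != [set f v1; f v2]%SET.
  by apply/eqP => /setP/(_ (f v0)); rewrite !inE !(inj_eq f_inj).
have : f v1 \in ([set f v0; f v1] :&: [set f v1; f v2])%SET by rewrite inE set21 set22.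
have disj (z : T) : z \in [set v0; v1]%SET -> z \in [set v2; v3]%SET -> False.
  by move=> /set2P[]-> /set2P[].
move: neq; case/set2P: e01 => ->; case/set2P: e12 => ->; rewrite ?eqxx //.
  by move=> _ /setIP[/disj].
by move=> _ /setIP[z23 /disj]; apply.
Qed.

Theorem theorem6p4 (P : sgraph -> Prop)
    (P_prop : graph_property P)
    (P_nontrivial : ~ trivial_property P)
    (P_hered : hereditary P) :
  (forall n : nat, A_ P !=set0 -> A_ P #= `I_n ->
     at_least_upto same_pair (mate_pair P) n) /\
  (infinite_set (A_ P) -> infinitely_many_upto same_pair (mate_pair P)) /\
  (A_ P = set0 -> infinitely_many_upto same_pair (mate_pair P)).
Proof.
split; last split.
(* Choose one pair of mates of order [g i] for each [i]; [g] is injective, so the orders tell these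
   pairs apart. *)
- move=> n _; rewrite card_eq_sym => /card_set_bijP[g [g_A g_inj _]].
  have /choice[f f_mates] : forall i : 'I_n, exists p,
      mate_pair P p /\ (graph_order p.1 = g i /\ graph_order p.2 = g i).
    by move=> i; have [p] := mates_of_A _ P_hered (g i) (g_A i (ltn_ord i)); exists p.
  exists f; split=> [i|i j /same_pair_order eq_ij]; first by case: (f_mates i).
  apply/val_inj/g_inj; rewrite ?inE ?ltn_ord//=.
  by case: (f_mates i) (f_mates j) eq_ij => _ [-> _] [_ [-> ->]] [].
- move=> A_inf; apply: infinitely_many_pairs => N.
  have [n An lt_Nn] : exists2 n, A_ P n & (N < n)%N.
    (* Otherwise [A_ P] would lie in the finite set of naturals below [N.+1]. *)
    apply: contrapT => A_le; apply: A_inf; apply: sub_finite_set (finite_II N.+1).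
    by move=> n An /=; rewrite ltnS leqNgt; apply/negP => ?; apply: A_le; exists n.
  by have [p p_mates [ord_p _]] := mates_of_A _ P_hered n An; exists p; rewrite ?ord_p.
- move=> A0; have [b P_hom] := homogeneous_property _ P_prop P_hered P_nontrivial A0.
  apply: infinitely_many_pairs => N.
  have [p p_mates ord_p] := homogeneous_mates _ _ N P_hom.
  by exists p; rewrite ?ord_p// ltnS -addn3 leq_addr.
Qed.
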